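(* Let $M$ be an $n$-dimensional smooth manifold, and let $F_1,F_2$ be manifolds on which $GL(n,\mathbb{R})$ acts on the left. For $i=1,2$ let $u_i\in F_i$, let $G_{u_i}$ be the isotropy group of $u_i$, and let $P_i=t_i^{-1}(u_i)$ be a $G_{u_i}$-structure on $M$ defined by an $F_i$-tensor $t_i$. Let $GL(n,\mathbb{R})$ act on $F=F_1\times F_2$ by $a(\xi_1,\xi_2)=(a\xi_1,a\xi_2)$, put $u=(u_1,u_2)$ and let $F_u$ be its orbit. Assume that there is a section of $\mathcal{F}M$ which takes values in $P_1\cap P_2$, and that the map $t=(t_1,t_2)$ is smooth as a mapping from $\mathcal{F}M$ into $F_u$. Then the intersection $P_1\cap P_2$ is a $G$-structure defined by a tensor, namely by the $F$-tensor $t$ (i.e. $P_1\cap P_2=t^{-1}(u)$), and its structure group is the intersection $G_{u_1}\cap G_{u_2}$.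
   Context: $\mathcal{F}M$ is the linear frame bundle of $M$, a principal $GL(n,\mathbb{R})$-bundle; a $G$-structure is a reduction of $\mathcal{F}M$ to a Lie subgroup $G\subset GL(n,\mathbb{R})$. If $GL(n,\mathbb{R})$ acts on the left on a manifold $F$, an $F$-tensor on $\mathcal{F}M$ is a differentiable map $t:\mathcal{F}M\to F$ with $t(za)=a^{-1}t(z)$ for all $a\in GL(n,\mathbb{R})$, $z\in\mathcal{F}M$. For $u\in F$, $G_u=\{a : au=u\}$ is the isotropy group and $F_u=\{au : a\in GL(n,\mathbb{R})\}$ the orbit. A $G_u$-structure $P$ is defined by the $F$-tensor $t$ if $t$ takes values in $F_u$, is differentiable as a map $\mathcal{F}M\to F_u$, and $P=t^{-1}(u)$. *)

(* Defs.v *)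
From HB Require Import structures.
From mathcomp Require Import all_boot all_order all_algebra.
From mathcomp Require Import all_classical all_reals all_analysis.

Set Implicit Arguments.
Unset Strict Implicit.
Unset Printing Implicit Defensive.

Import Order.TTheory GRing.Theory Num.Theory.
Import numFieldNormedType.Exports.

Local Open Scope classical_set_scope.
Local Open Scope ring_scope.

(* C^k and C^oo maps on an open subset U of a normed space; the spaces used
   below are finite dimensional, where f is C^(k+1) iff it is differentiable
   and all its directional derivatives are C^k. *)
Fixpoint Ck_on {R : realType} {V W : normedModType R} (k : nat) (U : set V)
    (f : V -> W) : Prop :=
  match k with
  | 0 => forall x, U x -> {for x, continuous f}
  | k'.+1 => (forall x, U x -> differentiable f x) /\
             (forall v : V, Ck_on k' U (fun x => 'D_v f x))
  end.

Definition smooth_on {R : realType} {V W : normedModType R} (U : set V)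
    (f : V -> W) : Prop := forall k, Ck_on k U f.

(* A chart on the set T with values in E. Only the values of cmap on cdom and
   those of cinv on the image of cdom are meaningful. *)
Record chart {R : realType} (T : Type) (E : normedModType R) := Chart {
  cdom : set T;
  cmap : T -> E;
  cinv : E -> T }.

Section SmoothStructures.
Context {R : realType} {T : Type} {E : normedModType R}.
Implicit Types (c d : chart T E) (A : set (chart T E)).

Definition cimg c : set E := cmap c @` cdom c.

Definition chart_wf c : Prop :=
  open (cimg c) /\ forall x, cdom c x -> cinv c (cmap c x) = x.

Definition transition c d : E -> E := cmap d \o cinv c.

Definition compatible c d : Prop :=
  open (cmap c @` (cdom c `&` cdom d)) /\
  smooth_on (cmap c @` (cdom c `&` cdom d)) (transition c d).

(* The topology defined by an atlas on the set S. *)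
Definition atlas_open (S : set T) A (W : set T) : Prop :=
  W `<=` S /\ forall c, A c -> open (cmap c @` (cdom c `&` W)).

Definition atlas_hausdorff (S : set T) A : Prop :=
  forall x y, S x -> S y -> x <> y ->
  exists U V, [/\ atlas_open S A U, atlas_open S A V, U x, V y
                & U `&` V = set0].

Definition atlas_second_countable (S : set T) A : Prop :=
  exists B : nat -> set T,
    (forall i, atlas_open S A (B i)) /\
    (forall W x, atlas_open S A W -> W x ->
       exists i, B i x /\ B i `<=` W).

(* A is an atlas making the subset S of T a smooth manifold modelled on E. The
   topology of S is the one defined by A; S inherits nothing from T. *)
Definition smooth_structure (S : set T) A : Prop :=
  [/\ (forall c, A c -> chart_wf c /\ cdom c `<=` S),
      (forall x, S x -> exists2 c, A c & cdom c x),
      (forall c d, A c -> A d -> compatible c d),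
      atlas_hausdorff S A
    & atlas_second_countable S A].

End SmoothStructures.

Record manifold (R : realType) (n : nat) := Manifold {
  mcarrier :> Type;
  matlas : set (chart mcarrier 'rV[R]_n);
  matlasP : smooth_structure setT matlas }.
Arguments matlas {R n} m _.

Definition prod_chart {R : realType} {T1 T2 : Type} {E1 E2 : normedModType R}
    (c1 : chart T1 E1) (c2 : chart T2 E2) : chart (T1 * T2) (E1 * E2)%type :=
  Chart (cdom c1 `*` cdom c2)
        (fun x => (cmap c1 x.1, cmap c2 x.2))
        (fun v => (cinv c1 v.1, cinv c2 v.2)).

Definition prod_atlas {R : realType} {T1 T2 : Type} {E1 E2 : normedModType R}
    (A1 : set (chart T1 E1)) (A2 : set (chart T2 E2)) :
    set (chart (T1 * T2) (E1 * E2)%type) :=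
  [set c | exists c1 c2, [/\ A1 c1, A2 c2 & c = prod_chart c1 c2]].

(* f is smooth near every point of D. In particular f is continuous there, and
   f maps D into the domain of the atlas B. *)
Definition smooth_map {R : realType} {T T' : Type} {E E' : normedModType R}
    (D : set T) (A : set (chart T E)) (B : set (chart T' E'))
    (f : T -> T') : Prop :=
  forall x, D x ->
  exists c d (V : set E),
    [/\ A c, B d & cdom c x] /\
    [/\ open V, V (cmap c x) & V `<=` cimg c] /\
    (forall v, V v -> cdom d (f (cinv c v))) /\
    smooth_on V (cmap d \o f \o cinv c).

Section GeneralLinearGroup.
Variables (R : realType) (n : nat).

(* Not {unit 'M[R]_n}: that needs a finite ring and n > 0. *)
Record GL := MkGL { glval :> 'M[R]_n; glvalP : glval \in unitmx }.

HB.instance Definition _ := [isSub for glval].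

Definition gl1 : GL := MkGL (unitmx1 R n).

Lemma glM_proof (a b : GL) : (a : 'M[R]_n) *m b \in unitmx.
Proof. by rewrite unitmx_mul !glvalP. Qed.
Definition glM (a b : GL) : GL := MkGL (glM_proof a b).

Lemma glV_proof (a : GL) : invmx a \in unitmx.
Proof. by rewrite unitmx_inv glvalP. Qed.
Definition glV (a : GL) : GL := MkGL (glV_proof a).

(* GL(n, R) as an open subset of the space of matrices. *)
Definition gl_atlas : set (chart GL 'M[R]_n) :=
  [set Chart setT glval (insubd gl1)].

(* A Lie subgroup is taken to be a subgroup which is an embedded submanifold,
   i.e. locally the zero set of a submersion. Isotropy groups of smooth
   actions, being closed, are of this kind. *)
Definition lie_subgroup (G : set GL) : Prop :=
  [/\ G gl1, (forall a b, G a -> G b -> G (glM a b)),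
      (forall a, G a -> G (glV a))
    & exists k : nat, forall a, G a ->
      exists (W : set 'M[R]_n) (f : 'M[R]_n -> 'rV[R]_k),
        [/\ open W, W a & smooth_on W f] /\
        (forall m, W m -> forall v, exists h, 'd f m h = v) /\
        (forall b : GL, W b -> (G b <-> f b = 0))].

End GeneralLinearGroup.

Section FrameBundle.
Variables (R : realType) (n : nat) (M : manifold R n).

Definition chart_at (p : M) (c : chart M 'rV[R]_n) : Prop :=
  matlas M c /\ cdom c p.

(* A tangent vector at p, as the family of its components in the charts at p;
   the components in the other charts are set to 0 so that equality of tangent
   vectors is equality of families. *)
Definition tangent_vector (p : M) (v : chart M 'rV[R]_n -> 'rV[R]_n) : Prop :=
  (forall c d, chart_at p c -> chart_at p d ->
     v d = 'd (transition c d) (cmap c p) (v c)) /\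
  (forall c, ~ chart_at p c -> v c = 0).

(* A point of the frame bundle: a base point and a basis of the tangent space
   there (the rows of the matrix are the components of the basis vectors). *)
Record frame := Frame {
  fbase : M;
  fvec : 'I_n -> chart M 'rV[R]_n -> 'rV[R]_n;
  fvec_tangent : forall j, tangent_vector fbase (fvec j);
  fvec_basis : forall c, chart_at fbase c ->
    \matrix_(j < n) fvec j c \in unitmx }.

Definition frame_mx (c : chart M 'rV[R]_n) (z : frame) : 'M[R]_n :=
  \matrix_(j < n) fvec z j c.

(* The charts of the frame bundle are induced by those of M. The inverse maps
   are only constrained where they are meaningful. *)
Definition frame_atlas : set (chart frame ('rV[R]_n * 'M[R]_n)%type) :=
  [set C | exists2 c, matlas M c &
     cdom C = @fbase @^-1` cdom c /\
     (forall z, cdom C z ->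
        cmap C z = (cmap c (fbase z), frame_mx c z) /\
        cinv C (cmap C z) = z)].

Definition frame_act_vec (z : frame) (a : GL R n) (j : 'I_n)
    (c : chart M 'rV[R]_n) : 'rV[R]_n :=
  \sum_(i < n) (a : 'M[R]_n) i j *: fvec z i c.

Lemma frame_act_tangent z a j : tangent_vector (fbase z) (frame_act_vec z a j).
Proof.
split=> [c d zc zd|c zc]; rewrite /frame_act_vec.
  rewrite linear_sum; apply: eq_bigr => i _.
  by have [H _] := fvec_tangent z i; rewrite linearZ /= -(H c d zc zd).
by rewrite big1 // => i _; have [_ H] := fvec_tangent z i; rewrite H ?scaler0.
Qed.

Lemma frame_act_basis z a c : chart_at (fbase z) c ->
  \matrix_(j < n) frame_act_vec z a j c \in unitmx.
Proof.
move=> zc; have -> : \matrix_(j < n) frame_act_vec z a j c =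
                     (a : 'M[R]_n)^T *m frame_mx c z.
  apply/matrixP => i k; rewrite !mxE summxE; apply: eq_bigr => l _.
  by rewrite !mxE.
by rewrite unitmx_mul unitmx_tr glvalP /=; apply: fvec_basis.
Qed.

(* The right action (X_1, ..., X_n) a = (sum_i a_i1 X_i, ..., sum_i a_in X_i). *)
Definition frame_act (z : frame) (a : GL R n) : frame :=
  Frame (frame_act_tangent z a) (@frame_act_basis z a).

(* A GL(n, R)-equivariant diffeomorphism over U from U * GL(n, R) to the
   restriction of the frame bundle to U, namely Phi, with inverse
   z |-> (fbase z, psi z). *)
Definition local_trivialization (U : set M) (Phi : M * GL R n -> frame)
    (psi : frame -> GL R n) : Prop :=
  [/\ smooth_map (U `*` setT) (prod_atlas (matlas M) (@gl_atlas R n))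
        frame_atlas Phi,
      smooth_map (@fbase @^-1` U) frame_atlas (@gl_atlas R n) psi,
      (forall x a, U x -> fbase (Phi (x, a)) = x /\ psi (Phi (x, a)) = a),
      (forall z, U (fbase z) -> Phi (fbase z, psi z) = z)
    & (forall x a b, U x -> Phi (x, glM a b) = frame_act (Phi (x, a)) b)].

(* P is a principal subbundle with group G: locally, the pair formed by the
   frame bundle and P is isomorphic to U * GL(n, R) and U * G. *)
Definition reduction (G : set (GL R n)) (P : set frame) : Prop :=
  forall x : M, exists U Phi psi,
    [/\ atlas_open setT (matlas M) U, U x,
        local_trivialization U Phi psi
      & forall z, U (fbase z) -> (P z <-> G (psi z))].

Definition G_structure (G : set (GL R n)) (P : set frame) : Prop :=
  lie_subgroup G /\ reduction G P.

End FrameBundle.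

Section Actions.
Variables (R : realType) (n : nat) (F : Type).
Variable act : GL R n -> F -> F.

Definition smooth_action {E : normedModType R} (A : set (chart F E)) : Prop :=
  [/\ (forall x, act (gl1 R n) x = x),
      (forall a b x, act (glM a b) x = act a (act b x))
    & smooth_map setT (prod_atlas (@gl_atlas R n) A) A
        (fun p => act p.1 p.2)].

Definition isotropy (u : F) : set (GL R n) := [set a | act a u = u].

Definition orbit (u : F) : set F := [set act a u | a in [set: GL R n]].

(* The maximal atlas, in dimension k, of the manifold structure of the orbit of
   u as the homogeneous space GL(n, R) / isotropy u. This is the only structure
   for which a |-> act a u is smooth and has local smooth sections through
   every point of the orbit; its topology is not that of F in general. *)
Definition orbit_atlas (u : F) (k : nat) : set (chart F 'rV[R]_k) :=
  [set C | [/\ chart_wf C, cdom C `<=` orbit u,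
      smooth_map [set a | cdom C (act a u)] (@gl_atlas R n) [set C]
        (act ^~ u)
    & forall v, cimg C v -> exists (V : set 'rV[R]_k) (s : 'rV[R]_k -> GL R n),
        [/\ open V, V v & V `<=` cimg C] /\
        smooth_on V (@glval R n \o s) /\
        (forall w, V w -> act (s w) u = cinv C w)]].

End Actions.

Section Tensors.
Variables (R : realType) (n : nat) (M : manifold R n).
Variables (F : Type) (act : GL R n -> F -> F).

Definition tensor {E : normedModType R} (A : set (chart F E))
    (t : frame M -> F) : Prop :=
  smooth_map setT (@frame_atlas R n M) A t /\
  forall z a, t (frame_act z a) = act (glV a) (t z).

Definition smooth_into_orbit (u : F) (t : frame M -> F) : Prop :=
  exists k : nat,
    smooth_structure (orbit act u) (@orbit_atlas R n F act u k) /\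
    smooth_map setT (@frame_atlas R n M) (@orbit_atlas R n F act u k) t.

(* P is a G-structure, with G the isotropy group of u, and P is defined by the
   tensor t. *)
Definition defined_by_tensor {E : normedModType R} (A : set (chart F E))
    (u : F) (t : frame M -> F) (P : set (frame M)) : Prop :=
  [/\ G_structure (isotropy act u) P,
      tensor A t,
      (forall z, orbit act u (t z)),
      smooth_into_orbit u t
    & P = t @^-1` [set u]].

End Tensors.

Definition prod_act {R : realType} {n : nat} {F1 F2 : Type}
    (act1 : GL R n -> F1 -> F1) (act2 : GL R n -> F2 -> F2) :
    GL R n -> F1 * F2 -> F1 * F2 :=
  fun a x => (act1 a x.1, act2 a x.2).

(* Main.v *)
From HB Require Import structures.
Require Import Defs.
From mathcomp Require Import all_boot all_order all_algebra.
From mathcomp Require Import all_classical all_reals all_analysis.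

Set Implicit Arguments.
Unset Strict Implicit.
Unset Printing Implicit Defensive.

Import Order.TTheory GRing.Theory Num.Theory.
Import numFieldNormedType.Exports.

Local Open Scope classical_set_scope.
Local Open Scope ring_scope.

(* Let u = (u1, u2), t = (t1, t2). The isotropy group of u is the intersection of
   those of u1 and u2, and P1 `&` P2 = t^-1(u) holds by definition. Everything
   else rests on the fact that the orbit map a |-> a u is a submersion onto the
   orbit, with smooth local sections, into which t is smooth. Hence the isotropy
   group of u is a fibre of a submersion, so a Lie subgroup. If Phi trivializes
   the frame bundle (one comes with P1), lifting x |-> t (Phi (x, 1)) through
   the orbit map gives a smooth g with g(x) u = t (Phi (x, 1)); the shifted
   trivialization (x, a) |-> Phi (x, g(x) a) then carries u at a = 1, so it
   identifies t^-1(u) with U * isotropy u. The section of P1 `&` P2 is only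
   needed to see that t takes its values in the orbit of u. *)

(** * Smooth maps between normed spaces *)

(** The remainder in the first-order expansion only sees values near [a], so the expansion of [f]
    with ['d f a] is also one for [g]; uniqueness of the differential concludes. *)
Lemma near_eq_differentiable (R : numFieldType) (V W : normedModType R)
    (f g : V -> W) (a : V) :
  {near a, f =1 g} -> differentiable f a -> differentiable g a.
Proof.
move=> fg /diff_locallyP[dfc dfe]; apply/diff_locallyP.
have ga : g a = f a by rewrite (nbhs_singleton fg).
have dge : g \o shift a = cst (g a) + ('d f a : V -> W) +o_ 0 id.
  apply/eqaddoP => e e0; move/eqaddoP : dfe => /(_ e e0); apply: filter_app.
  move: fg; rewrite (near_shift 0) subr0 => fg0; near=> h.
  have fgh : f (h + a) = g (h + a) by exact: (near fg0 h).
  by rewrite /= !fctE /= fgh -ga.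
by rewrite (diff_unique dfc dge).
Unshelve. all: by end_near. Qed.

Section CkCalculus.
Context {R : realType}.
Implicit Types V W X : normedModType R.

(** Around each point of the open set [U] the two maps agree on a neighbourhood, so their
    directional derivatives agree on [U] too. Below, this lets a derivative be replaced by a formula
    that is valid on [U] only. *)
Lemma Ck_on_eq V W k (U : set V) (f g : V -> W) :
  open U -> (forall x, U x -> f x = g x) -> Ck_on k U f -> Ck_on k U g.
Proof.
move=> oU; have nearU (f' g' : V -> W) x :
    (forall y, U y -> f' y = g' y) -> U x -> {near x, f' =1 g'}.
  by move=> fg Ux; near=> y; apply: fg; near: y; exact: open_nbhs_nbhs.
elim: k f g => [|k IH] f g fg /= => [cf x Ux|[df Df]].
  have := cf x Ux; rewrite /prop_for /continuous_at -fg// => fx.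
  apply: cvg_trans fx; apply: near_eq_cvg; exact: nearU.
split=> [x Ux|v]; first exact: near_eq_differentiable (nearU _ _ _ fg Ux) (df _ Ux).
apply: IH (Df v) => x Ux; exact/near_eq_derive/nearU.
Unshelve. all: by end_near. Qed.

Lemma Ck_onS V W k (U U' : set V) (f : V -> W) :
  U' `<=` U -> Ck_on k U f -> Ck_on k U' f.
Proof.
move=> sU; elim: k f => [|k IH] f /= => [cf x /sU|[df Df]]; first exact: cf.
by split=> [x /sU|v]; [exact: df|exact: IH].
Qed.

Lemma Ck_onW V W k (U : set V) (f : V -> W) : Ck_on k.+1 U f -> Ck_on k U f.
Proof.
elim: k f => [|k IH] f [df Df]; first by move=> x /df /differentiable_continuous.
by split=> // v; apply: IH.
Qed.

Lemma Ck_on_cst V W k (U : set V) (c : W) : Ck_on k U (cst c).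
Proof.
elim: k c => [|k IH] c /=; first by move=> x _; exact: cvg_cst.
split=> [x _|v]; first exact: differentiable_cst.
suff -> : 'D_v (cst c) = cst (0 : W) :> (V -> W) by [].
by apply/funext => x; rewrite derive_cst.
Qed.

Lemma Ck_on_lin V W k (U : set V) (L : {linear V -> W}) :
  continuous L -> Ck_on k U L.
Proof.
move=> cL; case: k => [x _|k]; first exact: cL.
split=> [x _|v]; first exact: linear_differentiable.
suff -> : 'D_v L = cst (L v) :> (V -> W) by exact: Ck_on_cst.
apply/funext => x; rewrite deriveE; last exact: linear_differentiable.
by rewrite diff_lin.
Qed.

Lemma Ck_on_lin_comp V W X k (U : set V) (L : {linear W -> X}) (f : V -> W) :
  continuous L -> open U -> Ck_on k U f -> Ck_on k U (L \o f).
Proof.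
move=> cL oU; have dL x := linear_differentiable x cL.
elim: k f => [|k IH] f /= => [cf x Ux|[df Df]].
  by apply: continuous_comp; [exact: cf|exact: cL].
split=> [x Ux|v]; first exact: differentiable_comp (df _ Ux) (dL _).
apply: Ck_on_eq oU _ (IH _ (Df v)) => x Ux.
have dfx := df x Ux.
rewrite [RHS]deriveE; last exact: differentiable_comp dfx (dL _).
by rewrite (diff_comp dfx (dL _)) (diff_lin _ cL) /= deriveE.
Qed.

Lemma Ck_onD V W k (U : set V) (f g : V -> W) : open U ->
  Ck_on k U f -> Ck_on k U g -> Ck_on k U (fun x => f x + g x).
Proof.
move=> oU; elim: k f g => [|k IH] f g /= => [cf cg x Ux|[df Df] [dg Dg]].
  by apply: cvgD; [exact: cf|exact: cg].
split=> [x Ux|v]; first exact: differentiableD (df _ Ux) (dg _ Ux).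
apply: Ck_on_eq oU _ (IH _ _ (Df v) (Dg v)) => x Ux.
by rewrite deriveD//; apply: diff_derivable; [exact: df|exact: dg].
Qed.

Lemma Ck_on_sum V W k (U : set V) (I : Type) (r : seq I) (P : pred I)
    (f : I -> V -> W) : open U ->
  (forall i, Ck_on k U (f i)) -> Ck_on k U (fun x => \sum_(i <- r | P i) f i x).
Proof.
move=> oU Cf; elim: r => [|i r IH].
  have -> : (fun x => \sum_(i <- [::] | P i) f i x) = cst 0.
    by apply/funext => x; rewrite big_nil.
  exact: Ck_on_cst.
under eq_fun do rewrite big_cons.
by case: (P i) => //; apply: Ck_onD.
Qed.

Lemma scale_is_bilinear W : bilinear_for
  (GRing.Scale.Law.clone _ _ *:%R _) (GRing.Scale.Law.clone _ _ *:%R _)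
  (@GRing.scale R W : R -> W -> W).
Proof.
split=> [w|r] a x y /=; first by rewrite scalerDl scalerA.
by rewrite scalerDr !scalerA mulrC.
Qed.

(** Leibniz rule: scaling is a continuous bilinear map, composed here with the pair [(a, f)]. *)
Lemma is_diff_scale V W (a : V -> R) (f : V -> W) x :
  differentiable a x -> differentiable f x ->
  is_diff x (fun y => a y *: f y) (fun h => a x *: 'd f x h + 'd a x h *: f x).
Proof.
move=> da df.
pose bM := bilinear_isBilinear.Build _ _ _ _ _ _ _ (@scale_is_bilinear W).
pose b : {bilinear R -> W -> W} := HB.pack (@GRing.scale R W : R -> W -> W) bM.
have cb : continuous (fun p => b p.1 p.2) by move=> p; exact: scale_continuous.
have dp := differentiable_pair da df.
have db : differentiable (fun p => b p.1 p.2) (a x, f x).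
  exact: differentiable_bilin.
have -> : (fun y => a y *: f y) = (fun p => b p.1 p.2) \o (fun y => (a y, f y)).
  by [].
apply: DiffDef; first exact: differentiable_comp.
by rewrite diff_comp// diff_bilin// diff_pair.
Qed.

Lemma Ck_onZ V W k (U : set V) (a : V -> R) (f : V -> W) : open U ->
  Ck_on k U a -> Ck_on k U f -> Ck_on k U (fun x => a x *: f x).
Proof.
move=> oU; elim: k a f => [|k IH] a f /= => [ca cf x Ux|[da Da] [df Df]].
  by apply: cvgZ; [exact: ca|exact: cf].
split=> [x Ux|v]; first by have [] := is_diff_scale (da _ Ux) (df _ Ux).
(* The product rule contains [a] and [f] undifferentiated, so their order is lowered to [k] before
   the induction hypothesis applies. *)
have Ca : Ck_on k U a by apply: Ck_onW; split.
have Cf : Ck_on k U f by apply: Ck_onW; split.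
apply: Ck_on_eq oU _ (Ck_onD oU (IH _ _ Ca (Df v)) (IH _ _ (Da v) Cf)) => x Ux.
have dax := da x Ux; have dfx := df x Ux.
have [d dE] := is_diff_scale dax dfx.
by rewrite [RHS]deriveE// dE !deriveE.
Qed.

Lemma Ck_onM V k (U : set V) (a b : V -> R) : open U ->
  Ck_on k U a -> Ck_on k U b -> Ck_on k U (fun x => a x * b x).
Proof. exact: Ck_onZ. Qed.

Lemma Ck_on_prod V k (U : set V) (I : Type) (r : seq I) (P : pred I)
    (f : I -> V -> R) : open U ->
  (forall i, Ck_on k U (f i)) -> Ck_on k U (fun x => \prod_(i <- r | P i) f i x).
Proof.
move=> oU Cf; elim: r => [|i r IH].
  have -> : (fun x => \prod_(i <- [::] | P i) f i x) = cst 1.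
    by apply/funext => x; rewrite big_nil.
  exact: Ck_on_cst.
under eq_fun do rewrite big_cons.
by case: (P i) => //; apply: Ck_onM.
Qed.

Lemma Ck_onV V k (U : set V) (a : V -> R) : open U ->
  (forall x, U x -> a x != 0) -> Ck_on k U a -> Ck_on k U (fun x => (a x)^-1).
Proof.
move=> oU a0; elim: k => [|k IH] /= => [ca x Ux|[da Da]].
  by apply: cvgV; [exact: a0|exact: ca].
split=> [x Ux|v]; first by apply: differentiableV; [exact: da|exact: a0].
have CV : Ck_on k U (fun x => (a x)^-1) by apply: IH; apply: Ck_onW; split.
(* This product is the derivative of [a^-1], namely [- a^-1 * a^-1 * 'D_v a]; it is C^k by
   induction. *)
have := Ck_onM oU (Ck_on_cst k U (-1 : R)) (Ck_onM oU (Ck_onM oU CV CV) (Da v)).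
apply: Ck_on_eq oU _ => x Ux; have dax := da x Ux; have ax0 := a0 x Ux.
rewrite [RHS]deriveE; last exact: differentiableV.
by rewrite diffV//= deriveE// mulN1r -expr2 exprVn scaleNr.
Qed.

Lemma Ck_on_pair V W X k (U : set V) (f : V -> W) (g : V -> X) : open U ->
  Ck_on k U f -> Ck_on k U g -> Ck_on k U (fun x => (f x, g x)).
Proof.
move=> oU; elim: k f g => [|k IH] f g /= => [cf cg x Ux|[df Df] [dg Dg]].
  by apply: cvg_pair; [exact: cf|exact: cg].
split=> [x Ux|v]; first exact: differentiable_pair (df _ Ux) (dg _ Ux).
apply: Ck_on_eq oU _ (IH _ _ (Df v) (Dg v)) => x Ux.
have dfx := df x Ux; have dgx := dg x Ux.
by rewrite !deriveE// ?diff_pair//; exact: differentiable_pair.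
Qed.

(** Finite dimensionality in the form used by the chain rule: continuous coordinates [l i] turn a
    differential into a finite sum of directional derivatives along the [e i]. *)
Definition finite_basis W := exists (I : finType) (e : I -> W) (l : I -> {linear W -> R}),
  (forall i, continuous (l i)) /\ forall w, w = \sum_i l i w *: e i.

Lemma Ck_on_comp V W X k (U : set V) (U' : set W) (f : V -> W) (g : W -> X) :
  finite_basis W -> open U -> (forall x, U x -> U' (f x)) ->
  Ck_on k U f -> Ck_on k U' g -> Ck_on k U (g \o f).
Proof.
move=> [I [e [l [cl lE]]]] oU fU.
elim: k f g fU => [|k IH] f g fU /= => [cf cg x Ux|[df Df] [dg Dg]].
  by apply: continuous_comp; [exact: cf|exact/cg/fU].
split=> [x Ux|v]; first exact: differentiable_comp (df _ Ux) (dg _ (fU _ Ux)).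
have Cf : Ck_on k U f by apply: Ck_onW; split.
(* The chain rule in coordinates: each term is a coordinate of ['D_v f] times a partial derivative
   of [g] composed with [f], and the induction hypothesis covers that composite. *)
have CS : Ck_on k U (fun x => \sum_i (l i \o 'D_v f) x *: ('D_(e i) g \o f) x).
  apply: Ck_on_sum => // i; apply: Ck_onZ => //.
    exact: Ck_on_lin_comp (cl i) oU (Df v).
  exact: IH.
apply: Ck_on_eq oU _ CS => x Ux; have dfx := df _ Ux; have dgx := dg _ (fU _ Ux).
rewrite deriveE; last exact: differentiable_comp.
rewrite diff_comp//= -(deriveE v dfx).
have -> : 'd g (f x) ('D_v f x) = 'd g (f x) (\sum_i l i ('D_v f x) *: e i).
  by rewrite -lE.
rewrite linear_sum.
by apply: eq_bigr => i _; rewrite linearZ /= -deriveE.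
Qed.

End CkCalculus.

(** * Matrices *)

Section MatrixCalculus.
Context {R : realType}.
Implicit Types V W X : normedModType R.

Definition mxcoord m p (i : 'I_m) (j : 'I_p) (A : 'M[R]_(m, p)) : R := A i j.

Lemma mxcoord_is_linear m p (i : 'I_m) (j : 'I_p) : linear (mxcoord i j).
Proof. by move=> a A B; rewrite /mxcoord !mxE. Qed.

HB.instance Definition _ m p (i : 'I_m) (j : 'I_p) :=
  GRing.isLinear.Build R 'M[R]_(m, p) R _ (mxcoord i j) (mxcoord_is_linear i j).

Lemma mxcoord_continuous m p (i : 'I_m) (j : 'I_p) : continuous (mxcoord i j).
Proof. exact: coord_continuous. Qed.

Lemma finite_basis_mx m p : finite_basis ('M[R]_(m, p)).
Proof.
exists ('I_m * 'I_p)%type, (fun q => delta_mx q.1 q.2), (fun q => mxcoord q.1 q.2).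
split=> [q|A]; first exact: mxcoord_continuous.
by rewrite [LHS]matrix_sum_delta pair_bigA.
Qed.

Lemma finite_basis_prod V W :
  finite_basis V -> finite_basis W -> finite_basis (V * W)%type.
Proof.
move=> [I [e [l [cl lE]]]] [J [e' [l' [cl' lE']]]].
pose L (q : I + J) : {linear (V * W)%type -> R} :=
  match q with inl i => l i \o fst | inr j => l' j \o snd end.
exists (I + J)%type, (fun q => match q with inl i => (e i, 0) | inr j => (0, e' j) end), L.
split=> [[i|j] v|[v w]] /=.
- by apply: continuous_comp; [exact: cvg_fst|exact: cl].
- by apply: continuous_comp; [exact: cvg_snd|exact: cl'].
rewrite big_sumType /=.
have -> : \sum_i l i v *: (e i, 0 : W) = (v, 0).
  rewrite {2}[v]lE; elim/big_rec2 : _ => // i y _ _ ->.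
  by congr (_, _); rewrite /= scaler0 addr0.
have -> : \sum_j l' j w *: (0 : V, e' j) = (0, w).
  rewrite {2}[w]lE'; elim/big_rec2 : _ => // i y _ _ ->.
  by congr (_, _); rewrite /= scaler0 addr0.
by congr (_, _); rewrite /= ?addr0 ?add0r.
Qed.

Lemma Ck_on_coord V m p k (U : set V) (A : V -> 'M[R]_(m, p)) i j : open U ->
  Ck_on k U A -> Ck_on k U (fun x => A x i j).
Proof. by move=> oU CA; have := Ck_on_lin_comp (@mxcoord_continuous m p i j) oU CA; exact. Qed.

Lemma Ck_on_mx V m p k (U : set V) (A : V -> 'M[R]_(m, p)) : open U ->
  (forall i j, Ck_on k U (fun x => A x i j)) -> Ck_on k U A.
Proof.
move=> oU CA; have -> : A = fun x => \sum_i \sum_j A x i j *: delta_mx i j.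
  by apply/funext => x; exact: matrix_sum_delta.
do 2![apply: Ck_on_sum => // ?]; apply: Ck_onZ => //; exact: Ck_on_cst.
Qed.

Lemma Ck_on_mulmx V m p q k (U : set V) (A : V -> 'M[R]_(m, p))
    (B : V -> 'M[R]_(p, q)) : open U ->
  Ck_on k U A -> Ck_on k U B -> Ck_on k U (fun x => A x *m B x).
Proof.
move=> oU CA CB; apply: Ck_on_mx => // i j; under eq_fun do rewrite mxE.
apply: Ck_on_sum => // l; apply: Ck_onM => //; exact: Ck_on_coord.
Qed.

Lemma Ck_on_det V m k (U : set V) (A : V -> 'M[R]_m) : open U ->
  Ck_on k U A -> Ck_on k U (fun x => \det (A x)).
Proof.
move=> oU CA; apply: Ck_on_sum => // s; apply: Ck_onM => //; first exact: Ck_on_cst.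
by apply: Ck_on_prod => // i; exact: Ck_on_coord.
Qed.

Lemma Ck_on_invmx V m k (U : set V) (A : V -> 'M[R]_m) : open U ->
  (forall x, U x -> A x \in unitmx) ->
  Ck_on k U A -> Ck_on k U (fun x => invmx (A x)).
Proof.
move=> oU uA CA.
(* Cramer's formula: the entries of the adjugate are cofactors, and the determinant does not vanish
   on [U]. *)
have CI : Ck_on k U (fun x => (\det (A x))^-1 *: \adj (A x)).
  apply: Ck_onZ => //.
    apply: Ck_onV => //; last exact: Ck_on_det.
    by move=> x /uA; rewrite unitmxE unitfE.
  apply: Ck_on_mx => // i j; under eq_fun do rewrite mxE.
  apply: Ck_onM => //; first exact: Ck_on_cst.
  apply: Ck_on_det => //; apply: Ck_on_mx => // i' j'.
  by under eq_fun do rewrite !mxE; exact: Ck_on_coord.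
by apply: Ck_on_eq oU _ CI => x /uA uAx; rewrite /invmx uAx.
Qed.

Lemma open_unitmx m : open [set A : 'M[R]_m | A \in unitmx].
Proof.
have cdet : continuous (fun A : 'M[R]_m => \det A).
  have Cd := @Ck_on_det 'M[R]_m m 0 setT id openT (Ck_on_lin 0 setT (L := idfun) (fun x => cvg_id)).
  by move=> A; apply: Cd.
have -> : [set A : 'M[R]_m | A \in unitmx] = (fun A => \det A) @^-1` [set x | x != 0].
  by apply/seteqP; split => A /=; rewrite unitmxE unitfE.
apply: open_comp; first by move=> A _; exact: cdet.
exact: open_neq.
Qed.

Lemma smooth_on_comp V W X (U : set V) (U' : set W) (f : V -> W) (g : W -> X) :
  finite_basis W -> open U -> (forall x, U x -> U' (f x)) ->
  smooth_on U f -> smooth_on U' g -> smooth_on U (g \o f).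
Proof. by move=> fW oU fU Cf Cg k; exact: Ck_on_comp fW oU fU (Cf k) (Cg k). Qed.

Lemma open_preimage V W (U : set V) (U' : set W) (f : V -> W) :
  open U -> open U' -> smooth_on U f -> open (U `&` f @^-1` U').
Proof.
move=> oU oU' Cf; rewrite openE => x [Ux fx].
apply: filterI; first exact: open_nbhs_nbhs.
by have := Cf 0%N x Ux; apply; exact: open_nbhs_nbhs.
Qed.

(* The change of coordinates of vectors, stacked as the rows of a matrix,
   associated with a change of coordinates tau of the base. *)
Definition frame_transition n (tau : 'rV[R]_n -> 'rV[R]_n)
    (q : 'rV[R]_n * 'M[R]_n) : 'rV[R]_n * 'M[R]_n :=
  (tau q.1, \matrix_(j < n) 'd tau (q.1) (row j q.2)).

Lemma smooth_on_frame_transition n (U : set 'rV[R]_n) tau : open U ->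
  smooth_on U tau -> smooth_on (fst @^-1` U) (@frame_transition n tau).
Proof.
move=> oU Ct k; pose U' : set ('rV[R]_n * 'M[R]_n) := fst @^-1` U.
have oU' : open U' by apply: open_comp => // q _; exact: cvg_fst.
have C1 : Ck_on k U' fst by apply: (@Ck_on_lin _ _ _ k U' fst) => q; exact: cvg_fst.
have C2 : Ck_on k U' snd by apply: (@Ck_on_lin _ _ _ k U' snd) => q; exact: cvg_snd.
have comp1 (X : normedModType R) (g : 'rV[R]_n -> X) :
    Ck_on k U g -> Ck_on k U' (g \o fst).
  by move=> Cg; apply: Ck_on_comp (finite_basis_mx 1 n) oU' _ C1 Cg.
apply: Ck_on_pair => //; first exact: comp1 (Ct k).
(* The differential is expanded along the standard basis; its partial derivatives are C^k because
   [tau] is C^(k+1). *)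
have CS : Ck_on k U' (fun q => \matrix_(j < n)
    \sum_i q.2 j i *: 'D_(delta_mx 0 i) tau (q.1)).
  apply: Ck_on_mx => // j l; under eq_fun do rewrite mxE.
  have := Ck_on_coord 0 l oU' (Ck_on_sum (index_enum 'I_n) xpredT oU' (fun i =>
    Ck_onZ oU' (Ck_on_coord j i oU' C2) (comp1 _ _ ((Ct k.+1).2 (delta_mx 0 i))))).
  exact.
apply: Ck_on_eq oU' _ CS => q /(Ct 1%N).1 dt.
apply/row_matrixP => j; rewrite !rowK.
rewrite [in RHS](row_sum_delta (row j q.2)) linear_sum.
by apply: eq_bigr => i _; rewrite linearZ mxE deriveE.
Qed.

End MatrixCalculus.

(** * Smoothness in charts *)

Section LocalRepresentatives.
Context {R : realType}.

(* Unlike in smooth_map, the charts c and d are prescribed and N need not lie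
   in the image of c: this makes the notion composable. *)
Definition smooth_in_charts {T T' : Type} {E E' : normedModType R}
    (c : chart T E) (d : chart T' E') (f : T -> T') (x : T) : Prop :=
  exists (N : set E) (th : E -> E'),
    [/\ open N, N (cmap c x), smooth_on N th
      & forall y, cdom c y -> N (cmap c y) ->
          cdom d (f y) /\ cmap d (f y) = th (cmap c y)].

(** This is the half of [chart_wf] that the charts in [frame_atlas] satisfy by definition. *)
Definition chart_inverse {T : Type} {E : normedModType R} (c : chart T E) : Prop :=
  forall x, cdom c x -> cinv c (cmap c x) = x.

Lemma chart_inj {T : Type} {E : normedModType R} (c : chart T E) x y :
  chart_inverse c -> cdom c x -> cdom c y -> cmap c x = cmap c y -> x = y.
Proof. by move=> ci cx cy xy; rewrite -(ci x cx) xy ci. Qed.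

Lemma smooth_on_in_charts {T T' : Type} {E E' : normedModType R}
    (c : chart T E) (d : chart T' E') (f : T -> T') x (V : set E) :
  chart_inverse c -> open V -> V (cmap c x) ->
  (forall v, V v -> cdom d (f (cinv c v))) ->
  smooth_on V (cmap d \o f \o cinv c) -> smooth_in_charts c d f x.
Proof.
move=> ci oV Vx dV sV; exists V, (cmap d \o f \o cinv c); split=> // y cy Vy.
by have := dV _ Vy; rewrite /= ci.
Qed.

(** Shrinking [N] to its trace on [V] places it in the image of [c], where [cinv c] is a true
    inverse and the representative equals [th]. *)
Lemma smooth_in_charts_on {T T' : Type} {E E' : normedModType R}
    (c : chart T E) (d : chart T' E') (f : T -> T') x (V : set E) :
  chart_inverse c -> open V -> V (cmap c x) -> V `<=` cimg c ->
  smooth_in_charts c d f x ->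
  exists V : set E, [/\ open V, V (cmap c x) & V `<=` cimg c] /\
    (forall v, V v -> cdom d (f (cinv c v))) /\
    smooth_on V (cmap d \o f \o cinv c).
Proof.
move=> ci oV Vx Vc [N [th [ oN Nx sth fth]]]; exists (V `&` N).
have oVO : open (V `&` N) by exact: openI.
split; first by split=> // v [/Vc].
split=> [v [/Vc[y cy <-] Ny]|k]; first by rewrite ci//; have [] := fth y cy Ny.
apply: Ck_on_eq oVO _ (Ck_onS _ (sth k)) => [v [/Vc[y cy <-] Ny]|v []//].
by rewrite /= ci//; have [_ ->] := fth y cy Ny.
Qed.

(** Both maps are read in the same middle chart [d], so the representatives compose on the part of
    [N] that [th] sends into [N']. *)
Lemma smooth_in_charts_comp {T T' T'' : Type} {E E' E'' : normedModType R}
    (c : chart T E) (d : chart T' E') (e : chart T'' E'')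
    (f : T -> T') (g : T' -> T'') x :
  finite_basis E' -> cdom c x -> smooth_in_charts c d f x ->
  smooth_in_charts d e g (f x) -> smooth_in_charts c e (g \o f) x.
Proof.
move=> fE' cx [N [th [ oN Nx sth fth]]] [N' [th' [ oN' Nx' sth' fth']]].
exists (N `&` th @^-1` N'), (th' \o th); split.
- exact: open_preimage.
- by split=> //=; have [_ <-] := fth x cx Nx.
- apply: (@smooth_on_comp R E E' E'' (N `&` th @^-1` N') N') => //.
  + exact: open_preimage.
  + by move=> v [].
  + by move=> k; exact: Ck_onS (sth k).
- move=> y cy [Ny /= Ny']; have [dy fy] := fth y cy Ny.
  by rewrite /= -fy; apply: fth' => //; rewrite fy.
Qed.

Lemma smooth_in_charts_pair {T T1 T2 : Type} {E E1 E2 : normedModType R}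
    (c : chart T E) (d1 : chart T1 E1) (d2 : chart T2 E2)
    (f1 : T -> T1) (f2 : T -> T2) x :
  smooth_in_charts c d1 f1 x -> smooth_in_charts c d2 f2 x ->
  smooth_in_charts c (prod_chart d1 d2) (fun y => (f1 y, f2 y)) x.
Proof.
move=> [N1 [th1 [ oN1 N1x sth1 fth1]]] [N2 [th2 [ oN2 N2x sth2 fth2]]].
have oN := openI oN1 oN2.
exists (N1 `&` N2), (fun v => (th1 v, th2 v)); split=> //.
- by move=> k; apply: Ck_on_pair => //; apply: Ck_onS; [|exact: sth1| |exact: sth2] => v [].
- move=> y cy [N1y N2y]; have [d1y f1y] := fth1 y cy N1y.
  by have [d2y f2y] := fth2 y cy N2y; rewrite /= f1y f2y.
Qed.

Lemma smooth_in_charts_cst {T T' : Type} {E E' : normedModType R}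
    (c : chart T E) (d : chart T' E') y0 x :
  cdom d y0 -> smooth_in_charts c d (cst y0) x.
Proof.
move=> dy0; exists setT, (cst (cmap d y0)); split=> //; first exact: openT.
by move=> k; exact: Ck_on_cst.
Qed.

Lemma smooth_in_charts_id {T : Type} {E : normedModType R} (c : chart T E) x :
  smooth_in_charts c c idfun x.
Proof.
exists setT, idfun; split=> //; first exact: openT.
by move=> k; apply: Ck_on_lin => v; exact: cvg_id.
Qed.

Lemma smooth_in_charts_fst {T T' : Type} {E E' : normedModType R}
    (c : chart T E) (d : chart T' E') x :
  smooth_in_charts (prod_chart c d) c fst x.
Proof.
exists setT, fst; split=> //; first exact: openT.
  by move=> k; apply: (@Ck_on_lin _ _ _ k setT fst) => v; exact: cvg_fst.
by move=> y [].
Qed.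

Lemma smooth_in_charts_snd {T T' : Type} {E E' : normedModType R}
    (c : chart T E) (d : chart T' E') x :
  smooth_in_charts (prod_chart c d) d snd x.
Proof.
exists setT, snd; split=> //; first exact: openT.
  by move=> k; apply: (@Ck_on_lin _ _ _ k setT snd) => v; exact: cvg_snd.
by move=> y [].
Qed.

Lemma smooth_in_charts_transition {T : Type} {E : normedModType R}
    (c d : chart T E) x :
  chart_inverse c -> compatible c d -> cdom c x -> cdom d x ->
  smooth_in_charts c d idfun x.
Proof.
move=> ci [ oN sO] cx dx; exists (cmap c @` (cdom c `&` cdom d)), (transition c d).
split=> //; first by exists x.
move=> y cy [y' [cy' dy']] /(chart_inj ci cy' cy) <-.
by rewrite /transition /= ci.
Qed.

End LocalRepresentatives.

(** * Charts of GL(n, R), of the manifold and of its frame bundle *)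

Section Charts.
Context {R : realType} {n : nat}.

Definition gl_chart : chart (GL R n) 'M[R]_n := Chart setT (@glval R n) (insubd (gl1 R n)).

Lemma gl_chart_wf : chart_wf gl_chart.
Proof.
split=> [|a _]; last exact: valKd.
suff -> : cimg gl_chart = [set A | A \in unitmx] by exact: open_unitmx.
apply/seteqP; split => [_ [a _ <-]|A uA]; first exact: glvalP.
by exists (MkGL uA).
Qed.

Lemma smooth_in_charts_glM p : smooth_in_charts (prod_chart gl_chart gl_chart)
  gl_chart (fun q => glM q.1 q.2) p.
Proof.
exists setT, (fun q => q.1 *m q.2); split=> //; first exact: openT.
move=> k; apply: Ck_on_mulmx; first exact: openT.
- by apply: (@Ck_on_lin _ _ _ k setT fst) => v; exact: cvg_fst.
- by apply: (@Ck_on_lin _ _ _ k setT snd) => v; exact: cvg_snd.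
Qed.

Lemma smooth_in_charts_glV a : smooth_in_charts gl_chart gl_chart (@glV R n) a.
Proof.
exists [set A | A \in unitmx], (@invmx R n); split=> //.
- exact: open_unitmx.
- exact: glvalP.
- move=> k; apply: (@Ck_on_invmx R 'M[R]_n n k _ idfun) => //.
    exact: open_unitmx.
  by apply: Ck_on_lin => v; exact: cvg_id.
Qed.

Variable M : manifold R n.

Lemma matlas_wf c : matlas M c -> chart_wf c.
Proof. by have [wf _ _ _ _] := matlasP M; move=> /wf[]. Qed.

Lemma matlas_inverse c : matlas M c -> chart_inverse c.
Proof. by move=> /matlas_wf[]. Qed.

Lemma matlas_transition c d x : matlas M c -> matlas M d -> cdom c x -> cdom d x ->
  smooth_in_charts c d idfun x.
Proof.
move=> Mc Md; apply: smooth_in_charts_transition; first exact: matlas_inverse.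
by have [_ _ + _ _] := matlasP M; apply.
Qed.

Lemma frame_atlas_inverse C : @frame_atlas R n M C -> chart_inverse C.
Proof. by move=> [c Mc [_ CE]] z /CE[]. Qed.

Lemma frame_mx_transition c d z : chart_at (fbase z) c -> chart_at (fbase z) d ->
  frame_transition (transition c d) (cmap c (fbase z), @frame_mx R n M c z) =
  (cmap d (fbase z), frame_mx d z).
Proof.
move=> zc zd; rewrite /frame_transition /=; congr (_, _).
  by rewrite /transition /= matlas_inverse//; case: zc.
apply/row_matrixP => j; rewrite !rowK.
by have [H _] := fvec_tangent z j; rewrite (H _ _ zc zd).
Qed.

(** The components of each basis vector change by the differential of the change of charts on [M],
    so the representative is [frame_transition], over the base coordinates of the overlap. *)
Lemma frame_atlas_transition C D z :
  @frame_atlas R n M C -> @frame_atlas R n M D -> cdom C z -> cdom D z ->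
  smooth_in_charts C D idfun z.
Proof.
move=> [c Mc [dC CE]] [d Md [dD DE]] Cz Dz.
have [_ _ /(_ c d Mc Md)[ oN sO] _ _] := matlasP M.
set N := cmap c @` _ in oN sO.
exists (fst @^-1` N), (frame_transition (transition c d)); split.
- by apply: open_comp => // q _; exact: cvg_fst.
- have [-> _] := CE z Cz; exists (fbase z) => //.
  by split; [rewrite dC in Cz|rewrite dD in Dz].
- exact: smooth_on_frame_transition.
- move=> y Cy; have [-> _] := CE y Cy; rewrite dC in Cy.
  move=> [x [cx dx] /= /(chart_inj (matlas_inverse Mc) cx Cy) xy].
  rewrite {}xy in cx dx; have Dy : cdom D y by rewrite dD.
  by split=> //; have [-> _] := DE y Dy; rewrite frame_mx_transition.
Qed.

Lemma frame_atlas_fbase C z : @frame_atlas R n M C -> cdom C z ->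
  exists c, [/\ matlas M c, cdom c (fbase z) & smooth_in_charts C c (@fbase R n M) z].
Proof.
move=> [c Mc [dC CE]] Cz; exists c; split=> //; first by rewrite dC in Cz.
exists setT, fst; split=> //; first exact: openT.
  by move=> k; apply: (@Ck_on_lin _ _ _ k setT fst) => v; exact: cvg_fst.
by move=> y Cy _; have [-> _] := CE y Cy; rewrite dC in Cy.
Qed.

End Charts.

(** * Passing between smooth maps and their chart representatives *)

Section SmoothMaps.
Context {R : realType} {T T' : Type} {E E' : normedModType R}.
Variables (D : set T) (A : set (chart T E)) (B : set (chart T' E')).
Hypothesis A_inverse : forall c, A c -> chart_inverse c.

(** The open set [V] is kept next to the representative: it witnesses that the image of [c] is a
    neighbourhood, which the way back to [smooth_map] requires. *)
Lemma smooth_map_in_charts f x : smooth_map D A B f -> D x ->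
  exists c d (V : set E), [/\ A c, B d & cdom c x] /\
    [/\ open V, V (cmap c x) & V `<=` cimg c] /\ smooth_in_charts c d f x.
Proof.
move=> sf /sf [c [d [V [[Ac Bd cx] [[ oV Vx Vc] [dV sV]]]]]].
exists c, d, V; do 2!split=> //.
by apply: smooth_on_in_charts oV Vx dV sV; exact: A_inverse.
Qed.

Lemma in_charts_smooth_map f :
  (forall x, D x -> exists c d (V : set E), [/\ A c, B d & cdom c x] /\
    [/\ open V, V (cmap c x) & V `<=` cimg c] /\ smooth_in_charts c d f x) ->
  smooth_map D A B f.
Proof.
move=> sf x /sf [c [d [V [[Ac Bd cx] [[ oV Vx Vc] sc]]]]].
have [V' V'P] := smooth_in_charts_on (A_inverse Ac) oV Vx Vc sc.
by exists c, d, V'.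
Qed.

End SmoothMaps.

Section ProductMaps.
Context {R : realType} {n : nat} {M : manifold R n}.

Lemma smooth_map_pair {T1 T2 : Type} {E1 E2 : normedModType R}
    (A1 : set (chart T1 E1)) (A2 : set (chart T2 E2))
    (t1 : frame M -> T1) (t2 : frame M -> T2) :
  smooth_map setT (@frame_atlas R n M) A1 t1 ->
  smooth_map setT (@frame_atlas R n M) A2 t2 ->
  smooth_map setT (@frame_atlas R n M) (prod_atlas A1 A2) (fun z => (t1 z, t2 z)).
Proof.
move=> s1 s2; apply: in_charts_smooth_map => [C|z _]; first exact: frame_atlas_inverse.
have finv C := @frame_atlas_inverse R n M C.
have [C [d1 [V [[AC Ad1 Cz] [VP sc1]]]]] := smooth_map_in_charts finv s1 (I : setT z).
have [C' [d2 [_ [[AC' Ad2 Cz'] [_ sc2]]]]] := smooth_map_in_charts finv s2 (I : setT z).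
exists C, (prod_chart d1 d2), V; split; first by split=> //; exists d1, d2.
split=> //; apply: smooth_in_charts_pair => //.
(* The two tensors come with different frame charts [C] and [C'] at [z]; a change of charts moves
   the second one to [C]. *)
apply: (smooth_in_charts_comp (d := C') (f := idfun) (g := t2)) => //.
  by apply: finite_basis_prod; exact: finite_basis_mx.
exact: frame_atlas_transition.
Qed.

Lemma gl_prod_chart_wf c : matlas M c -> chart_wf (prod_chart c (@gl_chart R n)).
Proof.
move=> Mc; have [ oc ci] := matlas_wf Mc; have [ og gi] := @gl_chart_wf R n.
split=> [|[x a] [/= cx _]]; last by rewrite ci// valKd.
suff -> : cimg (prod_chart c (@gl_chart R n)) =
    fst @^-1` cimg c `&` snd @^-1` cimg (@gl_chart R n).
  by apply: openI; apply: open_comp => // q _; [exact: cvg_fst|exact: cvg_snd].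
apply/seteqP; split=> [_ [[x a] [/= cx _] <-]|[v w] [[x cx /= xv] [a _ /= aw]]].
  by split; [exists x|exists a].
by exists (x, a); rewrite /= ?xv ?aw.
Qed.

End ProductMaps.

Section GroupLaws.
Context {R : realType} {n : nat}.
Implicit Types a b c : GL R n.

Lemma glMA a b c : glM a (glM b c) = glM (glM a b) c.
Proof. by apply: val_inj; exact: mulmxA. Qed.

Lemma gl1M a : glM (gl1 R n) a = a.
Proof. by apply: val_inj; exact: mul1mx. Qed.

Lemma glM1 a : glM a (gl1 R n) = a.
Proof. by apply: val_inj; exact: mulmx1. Qed.

Lemma glVM a : glM (glV a) a = gl1 R n.
Proof. by apply: val_inj; apply: mulVmx; exact: glvalP. Qed.

Lemma glMV a : glM a (glV a) = gl1 R n.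
Proof. by apply: val_inj; apply: mulmxV; exact: glvalP. Qed.

End GroupLaws.

(** * Isotropy groups as Lie subgroups *)

Section Isotropy.
Context {R : realType} {n : nat} {F : Type}.
Variables (act : GL R n -> F -> F) (u : F).
Hypothesis act1 : forall x, act (gl1 R n) x = x.
Hypothesis actM : forall a b x, act (glM a b) x = act a (act b x).

Lemma actVK a x : act (glV a) (act a x) = x.
Proof. by rewrite -actM glVM act1. Qed.

Lemma act_eq_isotropy a b : act a u = act b u -> isotropy act u (glM (glV a) b).
Proof. by move=> ab; rewrite /isotropy /= actM -ab actVK. Qed.

(* The orbit map a |-> act a u, read in a chart of the orbit, is a submersion
   since it has local sections through every point, and the isotropy group is
   one of its fibres. *)
Lemma isotropy_lie_subgroup k :
  smooth_structure (Defs.orbit act u) (@orbit_atlas R n F act u k) ->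
  lie_subgroup (isotropy act u).
Proof.
move=> [_ cover _ _ _]; rewrite /isotropy; split => /=.
- exact: act1.
- by move=> a b au bu; rewrite actM bu.
- by move=> a {1}<-; exact: actVK.
exists k => a au.
have [|C [[_ Ci] subC smC secC] Cu] := cover u; first by exists (gl1 R n).
(* Both atlases in [smC] are singletons, so [c] is the matrix chart and [d] is [C]; [h] is then the
   orbit map read in these charts. *)
have [|c [d [V [[ -> -> _] [[ oV Va Vc] [dV sV]]]]]] := smC a; first by rewrite /= au.
set h := _ \o cinv _ in sV.
have hE (b : GL R n) : h b = cmap C (act b u) by rewrite /h /= valKd.
have Vunit m : V m -> exists b : GL R n, m = b by move=> /Vc[b _ <-]; exists b.
exists V, (fun m => h m + cst (- cmap C u) m); split; last split.
- split=> // k'; apply: Ck_onD => //; exact: Ck_on_cst.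
- move=> m Vm v; have [b mb] := Vunit _ Vm.
  have Cb : cdom C (act b u) by have := dV _ Vm; rewrite mb /= valKd.
  have [|V' [s [[ oV' V'w V'c] [ss sE]]]] := secC (cmap C (act b u)).
    by exists (act b u).
  set w := cmap C (act b u) in V'w.
  (* [s w] and [b] move [u] to the same point, so [e] fixes [u]. Right translation by [e] therefore
     gives another section [sg] of the orbit map, now passing through [m] at [w]. *)
  pose e := glM (glV (s w)) b.
  have eu : act e u = u by apply: act_eq_isotropy; rewrite sE// Ci.
  pose sg w' : 'M[R]_n := s w' *m e.
  have Csg : smooth_on V' sg.
    by move=> k'; apply: Ck_on_mulmx (ss k') (Ck_on_cst _ _ _).
  have sgw : sg w = m by rewrite mb /sg /= mulmxA mulmxV ?mul1mx//; exact: glvalP.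
  have hsg w' : V' w' -> h (sg w') = w'.
    move=> V'w'; rewrite -[sg w']/(val (glM (s w') e)) hE actM eu sE//.
    by have /V'c[y Cy <-] := V'w'; rewrite Ci.
  have dsg : differentiable sg w by have [+ _] := Csg 1%N; apply.
  have dh : differentiable h (sg w) by have [+ _] := sV 1%N; apply; rewrite sgw.
  have df : differentiable (h + cst (- cmap C u)) (sg w).
    by apply: differentiableD => //; exact: differentiable_cst.
  (* Since [h \o sg] is the identity near [w], the chain rule sends this vector to [v]; the added
     constant has zero derivative. *)
  exists ('d sg w v); rewrite -sgw.
  transitivity ('D_v ((h + cst (- cmap C u)) \o sg) w).
    by rewrite (deriveE v (differentiable_comp dsg df)) (diff_comp dsg df).
  transitivity ('D_v (id + cst (- cmap C u)) w).
    apply: near_eq_derive; near=> w'.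
    rewrite /= !fctE hsg//; near: w'; exact: open_nbhs_nbhs.
  by rewrite deriveD ?derive_id ?derive_cst ?addr0//; exact: derivable_cst.
(* The zero set of the submersion is the isotropy group by injectivity of the chart [C] on its
   domain. *)
- move=> b Vb; rewrite hE /= /cst; split=> [->|/eqP]; first by rewrite subrr.
  rewrite subr_eq0 => /eqP; apply: chart_inj => //.
  by have := dV _ Vb; rewrite /= valKd.
Unshelve. all: by end_near. Qed.

End Isotropy.

(** * Shifting trivializations of the frame bundle *)

Section Trivializations.
Context {R : realType} {n : nat} {M : manifold R n}.

(** Openness in the atlas topology has to be tested in every chart [d], where the set becomes the
    preimage of [W] under the transition from [d] to [c]. *)
Lemma atlas_open_chart c (W : set 'rV[R]_n) : matlas M c -> open W ->
  atlas_open setT (matlas M) [set x | cdom c x /\ W (cmap c x)].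
Proof.
move=> Mc oW; split=> // d Md.
have [_ _ /(_ d c Md Mc)[ oN sN] _ _] := matlasP M.
suff -> : cmap d @` (cdom d `&` [set x | cdom c x /\ W (cmap c x)]) =
    cmap d @` (cdom d `&` cdom c) `&` transition d c @^-1` W by exact: open_preimage.
have di := matlas_inverse Md.
apply/seteqP; split=> [_ [x [dx [cx Wx]] <-]|_ [[x [dx cx] <-] Wx]].
  by split; [exists x|rewrite /= /transition /= di].
by exists x => //; move: Wx; rewrite /= /transition /= di.
Qed.

(** A trivialization near the base point identifies the fibre with GL(n, R), on which right
    translations are transitive. *)
Lemma frame_act_transitive G P (z w : frame M) : @reduction R n M G P ->
  fbase z = fbase w -> exists a, z = frame_act w a.
Proof.
move=> red zw; have [U [Phi [psi [_ Ux [_ _ _ Phipsi PhiM] _]]]] := red (fbase w).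
exists (glM (glV (psi w)) (psi z)).
by rewrite -{1}(Phipsi w)// -PhiM// glMA glMV gl1M -zw Phipsi// zw.
Qed.

(** Left multiplication by [g x] commutes with the right action, so equivariance survives; the
    inverse multiplies by [glV (g x)] on the left. *)
Lemma local_trivialization_shift (U U' : set M) Phi psi (g : M -> GL R n) :
  local_trivialization U Phi psi -> U' `<=` U ->
  (forall x, U' x -> exists c,
     [/\ matlas M c, cdom c x & smooth_in_charts c (@gl_chart R n) g x]) ->
  local_trivialization U' (fun p => Phi (p.1, glM (g p.1) p.2))
    (fun z => glM (glV (g (fbase z))) (psi z)).
Proof.
move=> [sPhi spsi fbpsi Phipsi PhiM] U'U sg.
(* Smoothness of [g] in one chart at [x] carries over to all of them, so the chart can be imposed by
   [Phi] or by the frame chart. *)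
have sg' c x : U' x -> matlas M c -> cdom c x ->
    smooth_in_charts c (@gl_chart R n) g x.
  move=> U'x Mc cx; have [d [Md dx sd]] := sg x U'x.
  have st := matlas_transition Mc Md cx dx.
  exact: smooth_in_charts_comp (finite_basis_mx _ _) cx st sd.
have fbG : finite_basis ('M[R]_n * 'M[R]_n)%type.
  by apply: finite_basis_prod; exact: finite_basis_mx.
have fbMG : finite_basis ('rV[R]_n * 'M[R]_n)%type.
  by apply: finite_basis_prod; exact: finite_basis_mx.
have inv_prod c : prod_atlas (matlas M) (@gl_atlas R n) c -> chart_inverse c.
  by move=> [c1 [c2 [Mc1 -> ->]]]; have [] := gl_prod_chart_wf Mc1.
split.
- apply: in_charts_smooth_map => // -[x a] [/= U'x _].
  have Uxga : (U `*` setT) (x, glM (g x) a) by split=> //; exact: U'U.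
  have [c' [C [_ [[[c [c2 [Mc c2E c'E]]] AC cx] [_ sc]]]]] :=
    smooth_map_in_charts inv_prod sPhi Uxga.
  move: c'E sc cx; rewrite c2E => -> {c' c2E c2} sc [/= cx _].
  pose cG := prod_chart c (@gl_chart R n).
  have ca : cdom cG (x, a) by split.
  exists cG, C, (cimg cG); split; first by split=> //; exists c, (@gl_chart R n).
  split; first by split=> //; [have [] := gl_prod_chart_wf Mc|exists (x, a)].
  (* The shifted map is assembled as [(x, a)] to [(x, g x a)], followed by [Phi]. *)
  have sg1 : smooth_in_charts cG (@gl_chart R n) (g \o fst) (x, a).
    apply: smooth_in_charts_comp ca (smooth_in_charts_fst _ _ _) _.
      exact: finite_basis_mx.
    exact: sg'.
  have sga := smooth_in_charts_comp fbG ca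
    (smooth_in_charts_pair sg1 (smooth_in_charts_snd _ _ _))
    (smooth_in_charts_glM _).
  exact: smooth_in_charts_comp fbMG ca
    (smooth_in_charts_pair (smooth_in_charts_fst _ _ _) sga) sc.
- apply: in_charts_smooth_map => [C|z /= U'z]; first exact: frame_atlas_inverse.
  have [C [d [V [[AC dE Cz] [VP sc]]]]] :=
    smooth_map_in_charts (@frame_atlas_inverse R n M) spsi (U'U _ U'z).
  rewrite dE in sc => {d dE}.
  exists C, (@gl_chart R n), V; split=> //; split=> //.
  have [c [Mc cz sb]] := frame_atlas_fbase AC Cz.
  have sgb := smooth_in_charts_comp (finite_basis_mx _ _) Cz sb (sg' _ _ U'z Mc cz).
  have sgV := smooth_in_charts_comp (finite_basis_mx _ _) Cz sgb
    (smooth_in_charts_glV _).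
  exact: smooth_in_charts_comp fbG Cz (smooth_in_charts_pair sgV sc)
    (smooth_in_charts_glM _).
- move=> x a /U'U Ux /=; have [-> ->] := fbpsi x (glM (g x) a) Ux.
  by rewrite glMA glVM gl1M.
- by move=> z /U'U Uz /=; rewrite glMA glMV gl1M Phipsi.
- by move=> x a b /U'U Ux /=; rewrite glMA PhiM.
Qed.

End Trivializations.

(** * Lifting a tensor through the orbit map and reducing the frame bundle *)

Section TensorReduction.
Context {R : realType} {n : nat} {M : manifold R n} {F : Type}.
Variables (act : GL R n -> F -> F) (u : F) (t : frame M -> F).
Hypothesis act1 : forall x, act (gl1 R n) x = x.
Hypothesis actM : forall a b x, act (glM a b) x = act a (act b x).
Hypothesis t_equiv : forall z a, t (frame_act z a) = act (glV a) (t z).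
Hypothesis t_smooth : smooth_into_orbit act u t.

Lemma local_lift (U : set M) Phi psi x0 : local_trivialization U Phi psi ->
  atlas_open setT (matlas M) U -> U x0 ->
  exists (U' : set M) (g : M -> GL R n),
  [/\ atlas_open setT (matlas M) U', U' x0, U' `<=` U,
      forall x, U' x -> act (g x) u = t (Phi (x, gl1 R n))
    & forall x, U' x -> exists c,
        [/\ matlas M c, cdom c x & smooth_in_charts c (@gl_chart R n) g x]].
Proof.
move=> [sPhi _ _ _ _] [_ oU] Ux0; have [k [_ st]] := t_smooth.
have inv_prod c : prod_atlas (matlas M) (@gl_atlas R n) c -> chart_inverse c.
  by move=> [c1 [c2 [Mc1 -> ->]]]; have [] := gl_prod_chart_wf Mc1.
have Ux1 : (U `*` setT) (x0, gl1 R n) by split.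
have [c' [C [_ [[[c [c2 [Mc c2E c'E]]] AC cx] [_ sc]]]]] :=
  smooth_map_in_charts inv_prod sPhi Ux1.
move: c'E sc cx; rewrite c2E => -> {c' c2E c2} sc [/= cx _].
have fbM : finite_basis ('rV[R]_n * 'M[R]_n)%type.
  by apply: finite_basis_prod; exact: finite_basis_mx.
have ssec : smooth_in_charts c C (fun x => Phi (x, gl1 R n)) x0.
  apply: (smooth_in_charts_comp (f := fun x => (x, gl1 R n)) fbM cx _ sc).
  apply: smooth_in_charts_pair; first exact: smooth_in_charts_id.
  exact: smooth_in_charts_cst.
have [C' [D [_ [[AC' AD C'z] [_ std]]]]] :=
  smooth_map_in_charts (@frame_atlas_inverse R n M) st (I : setT (Phi (x0, gl1 R n))).
have Cz : cdom C (Phi (x0, gl1 R n)).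
  have [N [th [ oN Nx _ fth]]] := ssec; by have [] := fth x0 cx Nx.
(* [Phi] and [t] are given in frame charts [C] and [C'] that may differ, hence the change of charts
   between them. *)
have st' := smooth_in_charts_comp fbM cx ssec
  (smooth_in_charts_comp fbM Cz (frame_atlas_transition AC AC' Cz C'z) std).
have [N [th [ oN Nx sth fth]]] := st'; have [[_ Di] _ _ secD] := AD.
have [Dt thx] := fth x0 cx Nx; rewrite /= in Dt thx fth.
(* The orbit map has a smooth section [s] near the value of the tensor at [x0]; the lift is [s]
   after the representative [th]. *)
have [|V [s [[ oV Vx VD] [ss sE]]]] := secD (th (cmap c x0)).
  by rewrite -thx; exists (t (Phi (x0, gl1 R n))).
(* The first factor keeps [th x] in the domain of [s]; the second keeps the points inside [U]. *)
pose W := (N `&` th @^-1` V) `&` cmap c @` (cdom c `&` U).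
have oNV : open (N `&` th @^-1` V) by exact: open_preimage.
have oW : open W by apply: openI => //; exact: oU.
exists [set x | cdom c x /\ W (cmap c x)], (fun x => s (th (cmap c x))).
split.
- exact: atlas_open_chart.
- by split=> //; split=> //; exists x0.
- move=> x [cx' [_ [x' [cx'' Ux'] ]]].
  by move=> /(chart_inj (matlas_inverse Mc) cx'' cx') <-.
- move=> x [cx' [[Nx' Vx'] _]]; rewrite sE//.
  by have [Dt' <-] := fth x cx' Nx'; rewrite Di.
- move=> x [cx' [NVx _]]; exists c; split=> //.
  exists (N `&` th @^-1` V), ((@glval R n \o s) \o th); split=> //.
  apply: (smooth_on_comp (U' := V)) => //; first exact: finite_basis_mx.
    by move=> v [].
  by move=> k'; apply: Ck_onS (sth k') => v [].
Qed.

Lemma tensor_reduction G P :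
  @reduction R n M G P -> reduction (isotropy act u) (t @^-1` [set u]).
Proof.
move=> red x0; have [U [Phi [psi [ oU Ux triv _]]]] := red x0.
have [U' [g [ oU' U'x U'U gE sg]]] := local_lift triv oU Ux.
have triv' := local_trivialization_shift triv U'U sg.
exists U', (fun p => Phi (p.1, glM (g p.1) p.2)),
  (fun z => glM (glV (g (fbase z))) (psi z)); split=> // z U'z.
(* The shifted frame is [Phi (x, 1)] moved by [g x], so equivariance applies the inverse of [g x] to
   [act (g x) u]. *)
have tu x : U' x -> t (Phi (x, glM (g x) (gl1 R n))) = u.
  move=> U'x'; have [_ _ _ _ PhiM] := triv.
  rewrite glM1 -[g x]gl1M PhiM; last exact: U'U.
  by rewrite t_equiv -gE// actVK.
(* In the shifted trivialization [z] is the frame at 1 moved by [a]; its tensor value is thus [u]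
   exactly when [a] fixes [u]. *)
set a := glM _ _; have tz : t z = act (glV a) u.
  have [_ _ _ Phipsi PhiM] := triv'.
  have := PhiM _ (gl1 R n) a U'z; rewrite gl1M Phipsi// => zE.
  by rewrite [in LHS]zE t_equiv tu.
rewrite /preimage /isotropy /= tz; split=> [au|{1}<-]; last exact: actVK.
by rewrite -[in RHS](act1 u) -(glMV a) actM au.
Qed.

End TensorReduction.

Theorem proposition2p10 (R : realType) (n k1 k2 : nat)
    (M : manifold R n) (F1 : manifold R k1) (F2 : manifold R k2)
    (act1 : GL R n -> F1 -> F1) (act2 : GL R n -> F2 -> F2)
    (hact1 : smooth_action act1 (matlas F1))
    (hact2 : smooth_action act2 (matlas F2))
    (u1 : F1) (u2 : F2) (t1 : frame M -> F1) (t2 : frame M -> F2)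
    (P1 P2 : set (frame M))
    (hP1 : defined_by_tensor act1 (matlas F1) u1 t1 P1)
    (hP2 : defined_by_tensor act2 (matlas F2) u2 t2 P2)
    (hsection : exists s : M -> frame M,
        forall x : M, fbase (s x) = x /\ (P1 `&` P2) (s x))
    (ht : smooth_into_orbit (prod_act act1 act2) (u1, u2)
            (fun z : frame M => (t1 z, t2 z))) :
  defined_by_tensor (prod_act act1 act2)
    (prod_atlas (matlas F1) (matlas F2)) (u1, u2)
    (fun z : frame M => (t1 z, t2 z)) (P1 `&` P2) /\
  G_structure (isotropy act1 u1 `&` isotropy act2 u2) (P1 `&` P2).
Proof.
have [[_ red] [st1 eq1] _ _ P1E] := hP1; have [_ [st2 eq2] _ _ P2E] := hP2.
have [act11 act1M _] := hact1; have [act21 act2M _] := hact2.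
set act := prod_act act1 act2 in ht *; set t := fun z => _ in ht *.
have actone x : act (gl1 R n) x = x by case: x => x y; rewrite /act /prod_act /= act11 act21.
have actM a b x : act (glM a b) x = act a (act b x).
  by rewrite /act /prod_act /= act1M act2M.
have tE z a : t (frame_act z a) = act (glV a) (t z).
  by rewrite /t /act /prod_act /= eq1 eq2.
have PE : P1 `&` P2 = t @^-1` [set (u1, u2)].
  by rewrite P1E P2E; apply/seteqP; split=> z; rewrite /t /= => -[-> ->].
have isoE : isotropy act (u1, u2) = isotropy act1 u1 `&` isotropy act2 u2.
  by apply/seteqP; split=> a; rewrite /isotropy /= /act /prod_act /= => -[-> ->].
(* The smooth structure of the orbit of the pair, contained in [ht], gives the Lie subgroup; the
   trivializations that come with [P1] give the reduction. *)
have Gst : G_structure (isotropy act (u1, u2)) (P1 `&` P2).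
  split; first by have [k [ok _]] := ht; exact: isotropy_lie_subgroup ok.
  by rewrite PE; exact: tensor_reduction red.
split; last by rewrite -isoE.
split=> //.
  by split=> //; exact: smooth_map_pair.
(* [z] is the frame of the section over the same base point moved by some [a]; the tensor is [u] on
   the section, hence [act (glV a) u] at [z]. *)
move=> z; have [s sP] := hsection; have [bs Ps] := sP (fbase z).
have [a ->] := frame_act_transitive red (esym bs).
by rewrite tE; rewrite PE in Ps; rewrite Ps; exists (glV a).
Qed.
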